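(* Let $0<p<\infty$ and let $f=p^+f^++p^-f^-:D\to\mathbb{B}$ be a function with idempotent components $f^\pm:D\to\mathbb{C}$. Then $f\in H^p(D,\mathbb{B})$ if and only if $(f^+)^*\in H^p(D)$ and $f^-\in H^p(D)$.
   Context: $D=\{z\in\mathbb{C}:|z|<1\}$, $z=x+iy$. $z^*$ denotes the complex conjugate of $z\in\mathbb{C}$; for a complex-valued function $g$, $g^*$ is its pointwise complex conjugate. The bicomplex numbers $\mathbb{B}$ are the elements $z_1+jz_2$ with $z_1,z_2\in\mathbb{C}$, $j^2=-1$, forming a commutative $\mathbb{C}$-algebra. Put $p^\pm=\frac12(1\pm ij)$; these are idempotents with $p^+p^-=0$ and $p^++p^-=1$. Every $w\in\mathbb{B}$ is uniquely $w=p^+w^++p^-w^-$ with $w^\pm\in\mathbb{C}$; for $\mathbb{B}$-valued functions $w^\pm$ are the component functions. The norm is $\|w\|_{\mathbb{B}}=\sqrt{(|w^+|^2+|w^-|^2)/2}$. $\bar\partial=\frac12\left(\frac{\partial}{\partial x}+j\frac{\partial}{\partial y}\right)$, equivalently $\bar\partial w=p^+\frac{\partial w^+}{\partial z}+p^-\frac{\partial w^-}{\partial z^*}$. $Hol(D,\mathbb{B})$ is the set of $f:D\to\mathbb{B}$ with $\bar\partial f=0$. $H^p(D,\mathbb{B})$ is the set of $f\in Hol(D,\mathbb{B})$ with $\|f\|_{H^p_{\mathbb{B}}}:=\sup_{0<r<1}\left(\int_0^{2\pi}\|f(re^{i\theta})\|_{\mathbb{B}}^p\,d\theta\right)^{1/p}<\infty$.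 $H^p(D)$ is the classical Hardy space of holomorphic $f:D\to\mathbb{C}$ with $\sup_{0<r<1}\int_0^{2\pi}|f(re^{i\theta})|^p\,d\theta<\infty$. *)

(* Defs.v *)
From Stdlib Require Import Reals Lra.
From Coquelicot Require Import Coquelicot.
Open Scope R_scope.

(* The bicomplex number z1 + j z2 is the pair (z1, z2). *)
Definition Bicomplex : Type := (C * C)%type.

Definition Badd (w v : Bicomplex) : Bicomplex :=
  ((fst w + fst v)%C, (snd w + snd v)%C).

Definition Bmul (w v : Bicomplex) : Bicomplex :=
  ((fst w * fst v - snd w * snd v)%C, (fst w * snd v + snd w * fst v)%C).

Definition BofC (z : C) : Bicomplex := (z, RtoC 0).

Definition Bj : Bicomplex := (RtoC 0, RtoC 1).

Definition pplus : Bicomplex :=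
  Bmul (BofC (/ 2)%C) (Badd (BofC 1) (Bmul (BofC Ci) Bj)).

Definition pminus : Bicomplex :=
  Bmul (BofC (/ 2)%C) (Badd (BofC 1) (Bmul (BofC (- Ci)%C) Bj)).

(* The element p^+ a + p^- b. *)
Definition Bidem (a b : C) : Bicomplex :=
  Badd (Bmul pplus (BofC a)) (Bmul pminus (BofC b)).

(* The components w^+, w^- of w; [Bidem_spec] characterises them. *)
Definition compp (w : Bicomplex) : C := (fst w - Ci * snd w)%C.
Definition compm (w : Bicomplex) : C := (fst w + Ci * snd w)%C.

Lemma pplusE : pplus = (RtoC (/ 2), (0, / 2)).
Proof.
unfold pplus, Bmul, Badd, BofC, Bj, Ci, Cmult, Cplus, Cminus, Copp, Cinv, RtoC.
simpl; repeat apply (f_equal2 pair); simpl; field.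
Qed.

Lemma pminusE : pminus = (RtoC (/ 2), (0, - / 2)).
Proof.
unfold pminus, Bmul, Badd, BofC, Bj, Ci, Cmult, Cplus, Cminus, Copp, Cinv, RtoC.
simpl; repeat apply (f_equal2 pair); simpl; field.
Qed.

Lemma pplus_idem : Bmul pplus pplus = pplus.
Proof.
rewrite ?pplusE, ?pminusE; unfold Bmul, Badd, BofC, Cmult, Cplus, Cminus, Copp, RtoC.
simpl; repeat apply (f_equal2 pair); simpl; field.
Qed.

Lemma pminus_idem : Bmul pminus pminus = pminus.
Proof.
rewrite ?pplusE, ?pminusE; unfold Bmul, Badd, BofC, Cmult, Cplus, Cminus, Copp, RtoC.
simpl; repeat apply (f_equal2 pair); simpl; field.
Qed.

Lemma pplus_pminus : Bmul pplus pminus = BofC 0.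
Proof.
rewrite ?pplusE, ?pminusE; unfold Bmul, Badd, BofC, Cmult, Cplus, Cminus, Copp, RtoC.
simpl; repeat apply (f_equal2 pair); simpl; field.
Qed.

Lemma pplus_add_pminus : Badd pplus pminus = BofC 1.
Proof.
rewrite ?pplusE, ?pminusE; unfold Bmul, Badd, BofC, Cmult, Cplus, Cminus, Copp, RtoC.
simpl; repeat apply (f_equal2 pair); simpl; field.
Qed.

Lemma Bidem_spec (w : Bicomplex) (a b : C) :
  w = Bidem a b <-> a = compp w /\ b = compm w.
Proof.
destruct w as [[x1 y1] [x2 y2]]; destruct a as [a1 a2]; destruct b as [b1 b2].
unfold Bidem; rewrite pplusE, pminusE.
unfold compp, compm, Bmul, Badd, BofC, Ci, Cmult, Cplus, Cminus, Copp, RtoC.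
simpl.
split.
- intros H; injection H as -> -> -> ->.
  split; apply (f_equal2 pair); simpl; field.
- intros [Ha Hb]; injection Ha as -> ->; injection Hb as -> ->.
  repeat apply (f_equal2 pair); simpl; field.
Qed.

Definition Bnorm (w : Bicomplex) : R :=
  sqrt ((Cmod (compp w) ^ 2 + Cmod (compm w) ^ 2) / 2).

Definition unit_disc (z : C) : Prop := Cmod z < 1.

(* Functions on the disc are represented by total functions on C of which only
   the values on [unit_disc] are ever used. *)

(* The real normed space underlying the bicomplex numbers. Its product norm is
   equivalent to [Bnorm]; it only serves to speak of real differentiability. *)
Definition B_R_NormedModule : NormedModule R_AbsRing :=
  prod_NormedModule R_AbsRing C_R_NormedModule C_R_NormedModule.

(* w is the value at z of (1/2) (d/dx + j d/dy) f. *)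
Definition is_dbar (f : C -> Bicomplex) (z : C) (w : Bicomplex) : Prop :=
  exists wx wy : Bicomplex,
    @is_derive R_AbsRing B_R_NormedModule
      (fun x : R => f (x, Im z)) (Re z) wx /\
    @is_derive R_AbsRing B_R_NormedModule
      (fun y : R => f (Re z, y)) (Im z) wy /\
    w = Bmul (BofC (/ 2)%C) (Badd wx (Bmul Bj wy)).

(* Real differentiability is required because mere existence of the partial
   derivatives would admit discontinuous solutions of the equation, such as
   those built from exp (- z ^ (-4)). *)
Definition HolB (f : C -> Bicomplex) : Prop :=
  forall z : C, unit_disc z ->
    @ex_filterdiff R_AbsRing C_R_NormedModule B_R_NormedModule
      f (@locally C_R_NormedModule z) /\
    is_dbar f z (BofC 0).

Definition HolC (f : C -> C) : Prop :=
  forall z : C, unit_disc z -> @ex_derive C_AbsRing C_NormedModule f z.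

(* x ^ s for x >= 0 and s > 0; [Rpower 0 s] is 1 rather than 0. *)
Definition rpow (x s : R) : R :=
  if Req_EM_T x 0 then 0 else Rpower x s.

Definition polar (r t : R) : C := (r * cos t, r * sin t).

(* The two suprema below are taken in the extended reals. [RInt] is a total
   function, but it is only used for functions that are continuous on the disc,
   so that the integrals exist. *)
Definition HpB_norm (p : R) (f : C -> Bicomplex) : Rbar :=
  Lub_Rbar (fun m : R => exists r : R, 0 < r < 1 /\
    m = rpow (RInt (fun t : R => rpow (Bnorm (f (polar r t))) p) 0 (2 * PI))
             (/ p)).

Definition HpB (p : R) (f : C -> Bicomplex) : Prop :=
  HolB f /\ Rbar_lt (HpB_norm p f) p_infty.

Definition HpC (p : R) (f : C -> C) : Prop :=
  HolC f /\
  Rbar_lt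
    (Lub_Rbar (fun m : R => exists r : R, 0 < r < 1 /\
       m = RInt (fun t : R => rpow (Cmod (f (polar r t))) p) 0 (2 * PI)))
    p_infty.

(* Main.v *)
Require Import Defs.
From Stdlib Require Import Reals Lra.
From Coquelicot Require Import Coquelicot.
Open Scope R_scope.

(** The theorem splits into a statement about holomorphy and one about growth.

    Holomorphy. Since j acts as -i on the p^+ component and as i on the p^-
    component, the equation [(1/2) (d/dx + j d/dy) f = 0] decouples into
    [d f^+ / dz = 0] and [d f^- / dz^* = 0]; conjugating the first turns it into
    [d (f^+)^* / dz^* = 0]. These are Cauchy-Riemann equations
    ([dbar_vanishes_components]). Together with real differentiability, which
    passes between f and its components because [compp], [compm], [Cconj] and
    [Bidem] are real-linear, they say that [(f^+)^*] and [f^-] are complex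
    differentiable ([complex_derive_CR]). Hence [HolB_iff].

    Growth. The norm of w is the root mean square m of the moduli [|w^+|] and
    [|w^-|], so that
      [m^p <= max(|w^+|, |w^-|)^p <= |w^+|^p + |w^-|^p]  and
      [|w^+|^p, |w^-|^p <= (sqrt 2)^p m^p].
    Convexity does not enter, so every p > 0 is covered. Integrating over the
    circle of radius r ([RInt_rpow_rms_le], [RInt_rpow_le_rms]) shows that the
    p-means of f are bounded in r exactly when those of both components are.
    Taking p-th roots of the means of f does not affect boundedness
    ([bounded_on_radii_root]). Holomorphy is used here only to make the
    integrands continuous, hence integrable. *)

(** * Real-linear maps on the complex and the bicomplex numbers *)

Local Notation C_R := C_R_NormedModule.
Local Notation B_R := B_R_NormedModule.

(* Reduces an identity between tuples of reals to one goal per coordinate. *)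
Ltac coords :=
  unfold Bidem, compp, compm; rewrite ?pplusE, ?pminusE;
  unfold Bmul, Badd, BofC, Bj, Cconj, Ci, Cmult, Cplus, Cminus, Copp, RtoC;
  repeat (unfold plus, scal, zero; simpl;
          unfold prod_plus, prod_scal, prod_zero, mult; simpl);
  repeat apply (f_equal2 pair); simpl; try field.

Lemma C_R_norm (x : C) : @norm R_AbsRing C_R x = Cmod x.
Proof.
unfold norm; simpl; unfold prod_norm, Cmod, norm; simpl; unfold abs; simpl.
f_equal; rewrite !Rmult_1_r, <- !Rabs_mult, !Rabs_pos_eq; auto; apply Rle_0_sqr.
Qed.

Lemma is_linear_coords (V : NormedModule R_AbsRing) (a b : V) :
  @is_linear R_AbsRing C_R V (fun h => plus (scal (fst h) a) (scal (snd h) b)).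
Proof.
apply (is_linear_comp
  (fun h : C_R => (scal (fst h) a, scal (snd h) b)) (fun u : V * V => plus (fst u) (snd u)));
  [ | apply is_linear_plus ].
apply is_linear_prod.
- apply (is_linear_comp (fun h : C_R => fst h) (fun k : R => scal k a)).
  + apply is_linear_fst.
  + apply (@is_linear_scal_l R_AbsRing V).
- apply (is_linear_comp (fun h : C_R => snd h) (fun k : R => scal k b)).
  + apply is_linear_snd.
  + apply (@is_linear_scal_l R_AbsRing V).
Qed.

Lemma real_linear_coords (V : NormedModule R_AbsRing) (l : C -> V) :
  (forall x y : C_R, l (plus x y) = plus (l x) (l y)) ->
  (forall (k : R) (x : C_R), l (scal k x) = scal k (l x)) ->
  forall h : C, l h = plus (scal (fst h) (l (1, 0))) (scal (snd h) (l (0, 1))).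
Proof.
intros Hp Hs [x y]; simpl; rewrite <- !Hs, <- Hp; f_equal.
unfold plus, scal; simpl; unfold prod_plus, prod_scal; simpl.
unfold plus, scal; simpl; unfold mult; simpl; f_equal; ring.
Qed.

(** [is_linear] asks for a bound on the operator norm; in finite dimension it
    comes for free from the expansion in coordinates. *)
Lemma is_linear_on_C (V : NormedModule R_AbsRing) (l : C -> V) :
  (forall x y : C_R, l (plus x y) = plus (l x) (l y)) ->
  (forall (k : R) (x : C_R), l (scal k x) = scal k (l x)) ->
  @is_linear R_AbsRing C_R V l.
Proof.
intros Hp Hs.
eapply is_linear_ext; [ | apply (is_linear_coords V (l (1, 0)) (l (0, 1))) ].
intros h; symmetry; apply (real_linear_coords V l Hp Hs).
Qed.

Lemma is_linear_on_B (V : NormedModule R_AbsRing) (l : Bicomplex -> V) :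
  (forall x y : B_R, l (plus x y) = plus (l x) (l y)) ->
  (forall (k : R) (x : B_R), l (scal k x) = scal k (l x)) ->
  @is_linear R_AbsRing B_R V l.
Proof.
intros Hp Hs.
apply is_linear_ext with
  (fun u : B_R => plus (l (fst u, zero)) (l (zero, snd u))).
{ intros [[] []]; rewrite <- Hp; apply f_equal; coords. }
apply (is_linear_comp (fun u : B_R => (l (fst u, zero), l (zero, snd u)))
  (fun u : V * V => plus (fst u) (snd u))); [ | apply is_linear_plus ].
apply is_linear_prod.
- apply (is_linear_comp (fun u : B_R => fst u : C_R) (fun x : C_R => l (x, zero))).
  + apply is_linear_fst.
  + apply is_linear_on_C; [ intros [] [] | intros k [] ];
      rewrite <- ?Hp, <- ?Hs; apply f_equal; coords.
- apply (is_linear_comp (fun u : B_R => snd u : C_R) (fun x : C_R => l (zero, x))).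
  + apply is_linear_snd.
  + apply is_linear_on_C; [ intros [] [] | intros k [] ];
      rewrite <- ?Hp, <- ?Hs; apply f_equal; coords.
Qed.

Lemma compp_linear : @is_linear R_AbsRing B_R C_R compp.
Proof. apply is_linear_on_B; intros; destruct x as [[] []]; try destruct y as [[] []]; coords. Qed.

Lemma compm_linear : @is_linear R_AbsRing B_R C_R compm.
Proof. apply is_linear_on_B; intros; destruct x as [[] []]; try destruct y as [[] []]; coords. Qed.

Lemma Cconj_linear : @is_linear R_AbsRing C_R C_R Cconj.
Proof. apply is_linear_on_C; intros; destruct x; try destruct y; coords. Qed.

Lemma Bidem_linear : @is_linear R_AbsRing B_R B_R (fun u => Bidem (fst u) (snd u)).
Proof. apply is_linear_on_B; intros; destruct x as [[] []]; try destruct y as [[] []]; coords. Qed.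

Lemma Cmult_linear (l : C) : @is_linear R_AbsRing C_R C_R (fun h => (h * l)%C).
Proof. apply is_linear_on_C; intros; destruct x, l; try destruct y; coords. Qed.

(** * Complex differentiability and the Cauchy-Riemann equation *)

(** Complex differentiability is real differentiability with a differential that
    is multiplication by a complex number. Both sides make the same remainder
    estimate; they differ in the neighbourhoods of z, made of discs on the left
    and of squares on the right, which [locally_C] identifies. *)
Lemma complex_derive_real_diff (g : C -> C) (z l : C) :
  @is_derive C_AbsRing C_NormedModule g z l <->
  @filterdiff R_AbsRing C_R C_R g (@locally C_R z) (fun h => (h * l)%C).
Proof.
split; intros [_ H]; split.
- apply Cmult_linear.
- intros x Hx; apply (@is_filter_lim_locally_unique R_AbsRing C_R) in Hx; subst x.
  intros eps; specialize (H z (fun P HP => HP) eps).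
  apply locally_C in H.
  revert H; apply filter_imp; intros y.
  rewrite !C_R_norm; exact (fun h => h).
- apply (@is_linear_scal_l C_AbsRing C_NormedModule).
- intros x Hx.
  apply (@is_filter_lim_locally_unique C_AbsRing (AbsRing_NormedModule C_AbsRing)) in Hx.
  subst x.
  intros eps; specialize (H z (fun P HP => HP) eps).
  apply locally_C.
  revert H; apply filter_imp; intros y.
  rewrite !C_R_norm; exact (fun h => h).
Qed.

(** The hypothesis says that l commutes with multiplication by i at 1, which is
    the Cauchy-Riemann equation for a differential. *)
Lemma complex_linear_of_real (l : C -> C) :
  @is_linear R_AbsRing C_R C_R l -> l (0, 1) = (Ci * l (1, 0))%C ->
  forall h, l h = (h * l (1, 0))%C.
Proof.
intros Hl E h.
rewrite (real_linear_coords C_R l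
  (@linear_plus R_AbsRing C_R C_R l Hl) (@linear_scal R_AbsRing C_R C_R l Hl) h), E.
destruct h, (l (1, 0)); coords.
Qed.

Lemma complex_derive_CR (g : C -> C) (z : C) :
  @ex_derive C_AbsRing C_NormedModule g z <->
  exists l : C -> C,
    @filterdiff R_AbsRing C_R C_R g (@locally C_R z) l /\ l (0, 1) = (Ci * l (1, 0))%C.
Proof.
split.
- intros [a Ha]; exists (fun h => (h * a)%C); split.
  + now apply complex_derive_real_diff.
  + destruct a; coords.
- intros (l & Hl & E); exists (l (1, 0)).
  apply complex_derive_real_diff.
  eapply filterdiff_ext_lin; [ exact Hl | ].
  apply complex_linear_of_real; [ apply (proj1 Hl) | exact E ].
Qed.

(** * The bicomplex Cauchy-Riemann operator in components *)

Lemma is_derive_along_line (U V : NormedModule R_AbsRing) (f : U -> V) (c v : U)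
    (t : R) (L : U -> V) :
  filterdiff f (locally (plus c (scal t v))) L ->
  is_derive (fun s : R => f (plus c (scal s v))) t (L v).
Proof.
intros H.
eapply filterdiff_ext_lin.
- apply (@filterdiff_comp' R_AbsRing R_NormedModule U V
    (fun s : R => plus c (scal s v)) f t (fun h => plus zero (scal h v)) L); [ | exact H ].
  apply (@filterdiff_plus_fct R_AbsRing R_NormedModule U (locally t) _
    (fun _ => c) (fun s => scal s v)).
  + apply (@filterdiff_const R_AbsRing R_NormedModule U (locally t) _ c).
  + apply filterdiff_linear, (@is_linear_scal_l R_AbsRing U).
- intros h; transitivity (L (scal h v)).
  + apply f_equal, plus_zero_l.
  + apply (linear_scal L (proj1 H)).
Qed.

Lemma is_derive_partial_x (V : NormedModule R_AbsRing) (f : C -> V) (z : C) (L : C -> V) :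
  @filterdiff R_AbsRing C_R V f (@locally C_R z) L ->
  is_derive (fun x : R => f (x, Im z)) (Re z) (L (1, 0)).
Proof.
intros H; destruct z as [x y].
apply (is_derive_ext (fun s : R => f (@plus C_R (0, y) (@scal R_Ring C_R s (1, 0))))).
{ intros s; apply f_equal; coords. }
apply is_derive_along_line.
replace (plus _ _) with ((x, y) : C_R) by coords; exact H.
Qed.

Lemma is_derive_partial_y (V : NormedModule R_AbsRing) (f : C -> V) (z : C) (L : C -> V) :
  @filterdiff R_AbsRing C_R V f (@locally C_R z) L ->
  is_derive (fun y : R => f (Re z, y)) (Im z) (L (0, 1)).
Proof.
intros H; destruct z as [x y].
apply (is_derive_ext (fun s : R => f (@plus C_R (x, 0) (@scal R_Ring C_R s (0, 1))))).
{ intros s; apply f_equal; coords. }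
apply is_derive_along_line.
replace (plus _ _) with ((x, y) : C_R) by coords; exact H.
Qed.

(** Reduces to the uniqueness of real-valued derivatives by applying the four
    real coordinate functions. *)
Lemma is_derive_B_unique (g : R -> Bicomplex) (t : R) (a b : Bicomplex) :
  @is_derive R_AbsRing B_R g t a -> @is_derive R_AbsRing B_R g t b -> a = b.
Proof.
intros Ha Hb.
assert (U : forall pi : B_R -> R, @is_linear R_AbsRing B_R R_NormedModule pi -> pi a = pi b).
{ intros pi Hpi.
  assert (D : forall c, @is_derive R_AbsRing B_R g t c ->
      is_derive (fun s : R => pi (g s)) t (pi c)).
  { intros c Hc; eapply filterdiff_ext_lin.
    - apply (@filterdiff_comp' R_AbsRing R_NormedModule B_R R_NormedModule g pi t
        (fun h => scal h c) pi Hc).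
      apply filterdiff_linear, Hpi.
    - intros h; apply (linear_scal pi Hpi). }
  rewrite <- (is_derive_unique _ _ _ (D a Ha)); apply is_derive_unique, D, Hb. }
assert (Lf : @is_linear R_AbsRing B_R C_R fst) by apply is_linear_fst.
assert (Ls : @is_linear R_AbsRing B_R C_R snd) by apply is_linear_snd.
assert (Cf : @is_linear R_AbsRing C_R R_NormedModule fst) by apply is_linear_fst.
assert (Cs : @is_linear R_AbsRing C_R R_NormedModule snd) by apply is_linear_snd.
pose proof (U _ (is_linear_comp _ _ Lf Cf)) as E1.
pose proof (U _ (is_linear_comp _ _ Lf Cs)) as E2.
pose proof (U _ (is_linear_comp _ _ Ls Cf)) as E3.
pose proof (U _ (is_linear_comp _ _ Ls Cs)) as E4.
destruct a as [[] []], b as [[] []]; simpl in *; congruence.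
Qed.

(** The partial derivatives in [is_dbar] are existentially quantified; for a
    differentiable function they can only be the values of the differential at 1
    and at i. *)
Lemma is_dbar_differential (f : C -> Bicomplex) (z : C) (L : C -> Bicomplex) (w : Bicomplex) :
  @filterdiff R_AbsRing C_R B_R f (@locally C_R z) L ->
  is_dbar f z w <-> w = Bmul (BofC (/ 2)%C) (Badd (L (1, 0)) (Bmul Bj (L (0, 1)))).
Proof.
intros H.
pose proof (is_derive_partial_x _ _ _ _ H) as Hx.
pose proof (is_derive_partial_y _ _ _ _ H) as Hy.
split.
- intros (wx & wy & Kx & Ky & ->).
  now rewrite (is_derive_B_unique _ _ _ _ Hx Kx), (is_derive_B_unique _ _ _ _ Hy Ky).
- intros ->; exists (L (1, 0)), (L (0, 1)); auto.
Qed.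

(** Multiplication by j is multiplication by -i on the plus component and by i on
    the minus component. Conjugating the plus equation gives both the form of
    the Cauchy-Riemann equation. *)
Lemma dbar_vanishes_components (wx wy : Bicomplex) :
  BofC 0 = Bmul (BofC (/ 2)%C) (Badd wx (Bmul Bj wy)) <->
  (Cconj (compp wy) = Ci * Cconj (compp wx) /\ compm wy = Ci * compm wx)%C.
Proof.
destruct wx as [[a b] [c d]], wy as [[a' b'] [c' d']].
unfold Bmul, Badd, BofC, Bj, compp, compm, Cconj, Ci, Cinv, Cmult, Cplus, Cminus, Copp, RtoC.
simpl; split.
- intros H; injection H; intros H1 H2 H3 H4.
  split; apply (f_equal2 pair); lra.
- intros [H1 H2]; injection H1; injection H2; intros.
  repeat apply (f_equal2 pair); simpl; lra.
Qed.

Lemma locally_unit_disc (z : C) :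
  unit_disc z -> @locally C_R z unit_disc.
Proof.
intros Hz; unfold unit_disc in *.
assert (Hc : @continuous C_R R_UniformSpace Cmod z).
{ apply (continuous_ext (fun x : C_R => norm x)); [ exact C_R_norm | apply filterlim_norm ]. }
apply (Hc (fun x : R => x < 1)), (open_lt 1 (Cmod z) Hz).
Qed.

Lemma compp_Bidem (a b : C) : compp (Bidem a b) = a.
Proof. symmetry; apply (proj1 (Bidem_spec _ a b) eq_refl). Qed.

Lemma compm_Bidem (a b : C) : compm (Bidem a b) = b.
Proof. symmetry; apply (proj1 (Bidem_spec _ a b) eq_refl). Qed.

(** The representation of f holds only on the disc, which is enough because the
    disc is a neighbourhood of z. *)
Lemma HolB_at_iff (f : C -> Bicomplex) (fp fm : C -> C)
    (hf : forall z : C, unit_disc z -> f z = Bidem (fp z) (fm z))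
    (z : C) : unit_disc z ->
  (@ex_filterdiff R_AbsRing C_R B_R f (@locally C_R z) /\ is_dbar f z (BofC 0)) <->
  (@ex_derive C_AbsRing C_NormedModule (fun z => Cconj (fp z)) z /\
   @ex_derive C_AbsRing C_NormedModule fm z).
Proof.
intros Hz.
pose proof (locally_unit_disc z Hz) as Hloc.
rewrite !complex_derive_CR; split.
- intros [[L HL] HD].
  apply (is_dbar_differential _ _ _ _ HL), dbar_vanishes_components in HD.
  destruct HD as [Ep Em]; split.
  + exists (fun h => Cconj (compp (L h))); split; [ | exact Ep ].
    apply (@filterdiff_ext_locally R_AbsRing C_R C_R (fun z => Cconj (compp (f z)))).
    { revert Hloc; apply filter_imp; intros y Hy; now rewrite (hf y Hy), compp_Bidem. }
    apply (@filterdiff_comp' R_AbsRing C_R B_R C_R f (fun w => Cconj (compp w)) z L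
      (fun w => Cconj (compp w)) HL).
    apply filterdiff_linear, (is_linear_comp _ _ compp_linear Cconj_linear).
  + exists (fun h => compm (L h)); split; [ | exact Em ].
    apply (@filterdiff_ext_locally R_AbsRing C_R C_R (fun z => compm (f z))).
    { revert Hloc; apply filter_imp; intros y Hy; now rewrite (hf y Hy), compm_Bidem. }
    apply (@filterdiff_comp' R_AbsRing C_R B_R C_R f compm z L compm HL).
    apply filterdiff_linear, compm_linear.
- intros [(lp & Hp & Ep) (lm & Hm & Em)].
  assert (HL : @filterdiff R_AbsRing C_R B_R f (@locally C_R z)
      (fun h => Bidem (Cconj (lp h)) (lm h))).
  { apply (@filterdiff_ext_locally R_AbsRing C_R B_R
      (fun z => Bidem (Cconj (Cconj (fp z))) (fm z))).
    { revert Hloc; apply filter_imp; intros y Hy.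
      now rewrite (hf y Hy), Cconj_conj. }
    apply (@filterdiff_comp'_2 R_AbsRing C_R C_R C_R B_R
      (fun z => Cconj (Cconj (fp z))) fm Bidem z (fun h => Cconj (lp h)) lm Bidem).
    - apply (@filterdiff_comp' R_AbsRing C_R C_R C_R (fun z => Cconj (fp z)) Cconj z lp Cconj Hp).
      apply filterdiff_linear, Cconj_linear.
    - exact Hm.
    - apply filterdiff_linear, Bidem_linear. }
  split; [ eexists; exact HL | ].
  apply (is_dbar_differential _ _ _ _ HL), dbar_vanishes_components.
  now rewrite !compp_Bidem, !compm_Bidem, !Cconj_conj.
Qed.

Lemma HolB_iff (f : C -> Bicomplex) (fp fm : C -> C)
    (hf : forall z : C, unit_disc z -> f z = Bidem (fp z) (fm z)) :
  HolB f <-> HolC (fun z => Cconj (fp z)) /\ HolC fm.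
Proof.
split.
- intros H; split; intros z Hz; apply (HolB_at_iff f fp fm hf z Hz), H, Hz.
- intros [Hp Hm] z Hz; apply (HolB_at_iff f fp fm hf z Hz); auto.
Qed.

Lemma HolC_continuous (g : C -> C) (z : C) :
  HolC g -> unit_disc z -> @continuous C_R C_R g z.
Proof.
intros H Hz; destruct (proj1 (complex_derive_CR g z) (H z Hz)) as (l & Hl & _).
apply filterdiff_continuous; now exists l.
Qed.

(** * Powers of nonnegative functions *)

Lemma rpow_ge0 (x s : R) : 0 <= rpow x s.
Proof.
unfold rpow; destruct Req_EM_T; [ lra | left; apply exp_pos ].
Qed.

Lemma rpow_le (x y s : R) : 0 < s -> 0 <= x <= y -> rpow x s <= rpow y s.
Proof.
intros Hs [Hx Hxy]; unfold rpow at 1; destruct (Req_EM_T x 0) as [_ | N].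
- apply rpow_ge0.
- unfold rpow; destruct (Req_EM_T y 0); [ lra | ].
  apply Rle_Rpower_l; lra.
Qed.

Lemma rpow_mult (x y s : R) : 0 <= x -> 0 <= y -> rpow (x * y) s = rpow x s * rpow y s.
Proof.
intros Hx Hy; unfold rpow.
destruct (Req_EM_T x 0) as [-> | Nx]; destruct (Req_EM_T y 0) as [-> | Ny];
  destruct (Req_EM_T _ 0) as [E | N]; try lra.
- apply Rmult_integral in E; lra.
- symmetry; apply Rpower_mult_distr; lra.
Qed.

Lemma rpow_rpow_inv (x s : R) : 0 < s -> 0 <= x -> rpow (rpow x (/ s)) s = x.
Proof.
intros Hs Hx; unfold rpow at 2; destruct (Req_EM_T x 0) as [-> | N].
- unfold rpow; destruct Req_EM_T; lra.
- unfold rpow; destruct Req_EM_T as [E | _].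
  + pose proof (exp_pos (/ s * ln x)); unfold Rpower in E; lra.
  + rewrite Rpower_mult, Rinv_l, Rpower_1; lra.
Qed.

(** Continuity at the zeros of h needs s > 0, and h >= 0 because [rpow] is 1 on
    the negative axis. *)
Lemma rpow_continuous (h : R -> R) (t s : R) :
  0 < s -> (forall u, 0 <= h u) -> continuous h t -> continuous (fun u => rpow (h u) s) t.
Proof.
intros Hs Hh Hc.
destruct (Rle_lt_or_eq_dec 0 (h t) (Hh t)) as [P | Z].
- (* Near a point where h is positive the power is exp (s ln h). *)
  apply (continuous_ext_loc _ (fun u => exp (s * ln (h u)))).
  + apply (filter_imp (fun u => 0 < h u)).
    * intros u Hu; unfold rpow, Rpower; destruct Req_EM_T; [ lra | reflexivity ].
    * apply (Hc (fun x => 0 < x)), (open_gt 0 (h t) P).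
  + apply continuous_exp_comp.
    apply (@continuous_scal_r R_UniformSpace R_AbsRing R_NormedModule s).
    apply (continuous_comp h ln); [ exact Hc | ].
    apply continuity_pt_filterlim, derivable_continuous_pt.
    exists (/ h t); apply derivable_pt_lim_ln, P.
- (* At a zero of h, the power is below eps as soon as h < eps^(1/s). *)
  apply filterlim_locally; intros eps.
  apply (filter_imp (fun u => h u < rpow eps (/ s))).
  + intros u Hu.
    assert (R0 : rpow (h t) s = 0).
    { unfold rpow; destruct Req_EM_T; lra. }
    rewrite R0; change (Rabs (rpow (h u) s - 0) < eps).
    rewrite Rminus_0_r, Rabs_pos_eq by apply rpow_ge0.
    destruct eps as [e He]; simpl in *.
    destruct (Req_EM_T (h u) 0) as [E0 | N].
    * unfold rpow; destruct Req_EM_T; lra.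
    * rewrite <- (rpow_rpow_inv e s Hs) by lra.
      specialize (Hh u).
      unfold rpow at 1 2; destruct (Req_EM_T (h u) 0); [ lra | ].
      destruct Req_EM_T; [ lra | ].
      apply exp_increasing, Rmult_lt_compat_l, ln_increasing; lra.
  + apply (Hc (fun x => x < rpow eps (/ s))).
    apply open_lt; rewrite <- Z.
    unfold rpow; destruct Req_EM_T; [ destruct eps; simpl in *; lra | apply exp_pos ].
Qed.

(** * Values on circles *)

Lemma polar_in_disc (r t : R) : 0 < r < 1 -> unit_disc (polar r t).
Proof.
intros Hr; unfold unit_disc, polar, Cmod; simpl.
replace (_ + _) with (r * r * (Rsqr (sin t) + Rsqr (cos t))) by (unfold Rsqr; ring).
rewrite sin2_cos2, Rmult_1_r, sqrt_square; lra.
Qed.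

Lemma polar_continuous (r t : R) : @continuous R_UniformSpace C_R (polar r) t.
Proof.
apply (@continuous_comp_2 R_UniformSpace R_UniformSpace R_UniformSpace C_R
  (fun t => r * cos t) (fun t => r * sin t) (fun a b => (a, b))).
- apply (@continuous_scal_r R_UniformSpace R_AbsRing R_NormedModule r), continuous_cos.
- apply (@continuous_scal_r R_UniformSpace R_AbsRing R_NormedModule r), continuous_sin.
- eapply continuous_ext; [ | apply continuous_id ]; intros []; reflexivity.
Qed.

Lemma Cmod_HolC_polar_continuous (g : C -> C) (r t : R) :
  HolC g -> 0 < r < 1 -> continuous (fun t => Cmod (g (polar r t))) t.
Proof.
intros Hg Hr.
apply (continuous_ext (fun t => @norm R_AbsRing C_R (g (polar r t)))).
{ intros; apply C_R_norm. }
apply (continuous_comp (fun t => g (polar r t) : C_R) norm).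
- apply (@continuous_comp R_UniformSpace C_R C_R (polar r) g).
  + apply polar_continuous.
  + apply HolC_continuous; [ exact Hg | apply polar_in_disc, Hr ].
- apply filterlim_norm.
Qed.

(** * The root mean square of two functions *)

Definition rms (x y : R) : R := sqrt ((x ^ 2 + y ^ 2) / 2).

Lemma rms_ge0 (x y : R) : 0 <= rms x y.
Proof. apply sqrt_pos. Qed.

Lemma rms_comm (x y : R) : rms x y = rms y x.
Proof. unfold rms; now rewrite Rplus_comm. Qed.

(** The root mean square is at most the larger of the two numbers, whose power is
    one of the two summands. *)
Lemma rpow_rms_le (s x y : R) : 0 < s -> 0 <= x -> 0 <= y ->
  rpow (rms x y) s <= rpow x s + rpow y s.
Proof.
intros Hs.
assert (M : forall u v, 0 <= u <= v -> rpow (rms u v) s <= rpow u s + rpow v s).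
{ intros u v Huv; apply Rle_trans with (rpow v s);
    [ | pose proof (rpow_ge0 u s); lra ].
  apply rpow_le; [ exact Hs | split; [ apply rms_ge0 | ] ].
  rewrite <- (sqrt_pow2 v) at 2 by lra; apply sqrt_le_1_alt.
  assert (u ^ 2 <= v ^ 2) by (apply pow_incr; lra); lra. }
intros Hx Hy; destruct (Rle_dec x y); [ apply M; lra | ].
rewrite rms_comm, Rplus_comm; apply M; lra.
Qed.

(** [sqrt 2 * rms x y] is the Euclidean norm of (x, y). *)
Lemma rpow_le_rms (s x y : R) : 0 < s -> 0 <= x ->
  rpow x s <= rpow (sqrt 2) s * rpow (rms x y) s.
Proof.
intros Hs Hx; rewrite <- rpow_mult by apply sqrt_pos.
apply rpow_le; [ exact Hs | split; [ exact Hx | ] ].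
unfold rms; rewrite <- sqrt_mult_alt by lra.
rewrite <- (sqrt_pow2 x) at 1 by lra; apply sqrt_le_1_alt.
pose proof (pow2_ge_0 y); lra.
Qed.

Lemma rms_continuous (u v : R -> R) (t : R) :
  continuous u t -> continuous v t -> continuous (fun t => rms (u t) (v t)) t.
Proof.
assert (Hsq : forall w : R -> R, continuous w t -> continuous (fun t => w t ^ 2) t).
{ intros w Hw; apply (continuous_comp w (fun x => x ^ 2)); [ exact Hw | ].
  apply (ex_derive_continuous (V := R_NormedModule)); auto_derive; auto. }
intros Hu Hv; apply (continuous_comp _ sqrt); [ | apply continuous_sqrt ].
apply (continuous_mult (K := R_AbsRing)); [ | apply continuous_const ].
apply (continuous_plus (V := R_NormedModule)); now apply Hsq.
Qed.

Lemma ex_RInt_rpow (s a b : R) (u : R -> R) :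
  0 < s -> (forall t, 0 <= u t) -> (forall t, continuous u t) ->
  ex_RInt (fun t => rpow (u t) s) a b.
Proof.
intros Hs Hu Cu; apply (@ex_RInt_continuous R_CompleteNormedModule); intros t _.
now apply rpow_continuous.
Qed.

Lemma ex_RInt_rpow_rms (s a b : R) (u v : R -> R) :
  0 < s -> (forall t, continuous u t) -> (forall t, continuous v t) ->
  ex_RInt (fun t => rpow (rms (u t) (v t)) s) a b.
Proof.
intros Hs Cu Cv; apply ex_RInt_rpow; [ exact Hs | intros; apply rms_ge0 | ].
intros; now apply rms_continuous.
Qed.

Lemma RInt_rpow_rms_le (s a b : R) (u v : R -> R) :
  0 < s -> a <= b ->
  (forall t, 0 <= u t) -> (forall t, 0 <= v t) ->
  (forall t, continuous u t) -> (forall t, continuous v t) ->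
  RInt (fun t => rpow (rms (u t) (v t)) s) a b <=
  RInt (fun t => rpow (u t) s) a b + RInt (fun t => rpow (v t) s) a b.
Proof.
intros Hs Hab Hu Hv Cu Cv.
rewrite <- (RInt_plus (V := R_CompleteNormedModule)) by now apply ex_RInt_rpow.
apply RInt_le; [ exact Hab | now apply ex_RInt_rpow_rms | | ].
- apply (ex_RInt_plus (V := R_NormedModule)); now apply ex_RInt_rpow.
- intros t _; now apply rpow_rms_le.
Qed.

Lemma RInt_rpow_le_rms (s a b : R) (u v : R -> R) :
  0 < s -> a <= b -> (forall t, 0 <= u t) ->
  (forall t, continuous u t) -> (forall t, continuous v t) ->
  RInt (fun t => rpow (u t) s) a b <=
  rpow (sqrt 2) s * RInt (fun t => rpow (rms (u t) (v t)) s) a b.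
Proof.
intros Hs Hab Hu Cu Cv.
rewrite <- (RInt_scal (V := R_CompleteNormedModule)) by now apply ex_RInt_rpow_rms.
apply RInt_le; [ exact Hab | now apply ex_RInt_rpow | | ].
- apply (ex_RInt_scal (V := R_NormedModule)); now apply ex_RInt_rpow_rms.
- intros t _; now apply rpow_le_rms.
Qed.

(** * Boundedness of means over all radii *)

Lemma Lub_Rbar_finite_iff (E : R -> Prop) :
  Rbar_lt (Lub_Rbar E) p_infty <-> exists M : R, forall m, E m -> m <= M.
Proof.
destruct (Lub_Rbar_correct E) as [Hub Hleast]; split.
- destruct (Lub_Rbar E) as [l | | ]; simpl; intros H; try contradiction.
  + exists l; intros m Hm; exact (Hub m Hm).
  + (* The least upper bound is minus infinity only for the empty set. *)
    exists 0; intros m Hm; destruct (Hub m Hm).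
- intros [M HM]; apply (Rbar_le_lt_trans _ M); [ | exact I ].
  apply Hleast; intros m Hm; exact (HM m Hm).
Qed.

Definition bounded_on_radii (I : R -> R) : Prop :=
  exists M : R, forall r : R, 0 < r < 1 -> I r <= M.

Lemma Lub_radii_finite_iff (I : R -> R) :
  Rbar_lt (Lub_Rbar (fun m => exists r, 0 < r < 1 /\ m = I r)) p_infty <->
  bounded_on_radii I.
Proof.
rewrite Lub_Rbar_finite_iff; split; intros [M HM]; exists M.
- intros r Hr; apply HM; now exists r.
- intros m (r & Hr & ->); now apply HM.
Qed.

Lemma bounded_on_radii_root (s : R) (I : R -> R) :
  0 < s -> (forall r, 0 < r < 1 -> 0 <= I r) ->
  bounded_on_radii (fun r => rpow (I r) (/ s)) <-> bounded_on_radii I.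
Proof.
intros Hs HI; split; intros [M HM].
- exists (rpow M s); intros r Hr.
  rewrite <- (rpow_rpow_inv (I r) s Hs (HI r Hr)).
  apply rpow_le; [ exact Hs | split; [ apply rpow_ge0 | now apply HM ] ].
- exists (rpow M (/ s)); intros r Hr.
  apply rpow_le; [ now apply Rinv_0_lt_compat | split; [ now apply HI | now apply HM ] ].
Qed.

(** The conjugate is inserted so that the moduli are those of the two functions
    that are holomorphic in the classical sense. *)
Lemma Bnorm_Bidem (a b : C) : Bnorm (Bidem a b) = rms (Cmod (Cconj a)) (Cmod b).
Proof. unfold Bnorm; now rewrite compp_Bidem, compm_Bidem, Cmod_conj. Qed.

Theorem theorem4p1 (p : R) (hp : 0 < p)
    (f : C -> Bicomplex) (fp fm : C -> C)
    (hf : forall z : C, unit_disc z -> f z = Bidem (fp z) (fm z)) :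
  HpB p f <-> HpC p (fun z : C => Cconj (fp z)) /\ HpC p fm.
Proof.
assert (HPI : 0 <= 2 * PI) by (pose proof PI_RGT_0; lra).
pose (u := fun r t => Cmod (Cconj (fp (polar r t)))).
pose (v := fun r t => Cmod (fm (polar r t))).
assert (Hu : forall r t, 0 <= u r t) by (intros; apply Cmod_ge_0).
assert (Hv : forall r t, 0 <= v r t) by (intros; apply Cmod_ge_0).
assert (Hw : forall r, 0 < r < 1 ->
  RInt (fun t => rpow (Bnorm (f (polar r t))) p) 0 (2 * PI) =
  RInt (fun t => rpow (rms (u r t) (v r t)) p) 0 (2 * PI)).
{ intros r Hr; apply RInt_ext; intros t _.
  now rewrite (hf _ (polar_in_disc r t Hr)), Bnorm_Bidem. }
(* Holomorphy is settled by [HolB_iff]; the equivalence of the growth conditions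
   may assume it. *)
enough (E : HolC (fun z => Cconj (fp z)) -> HolC fm ->
  Rbar_lt (HpB_norm p f) p_infty <->
  bounded_on_radii (fun r => RInt (fun t => rpow (u r t) p) 0 (2 * PI)) /\
  bounded_on_radii (fun r => RInt (fun t => rpow (v r t) p) 0 (2 * PI))).
{ unfold HpB, HpC; rewrite (HolB_iff f fp fm hf), !Lub_radii_finite_iff; tauto. }
intros Hp Hm.
assert (Cu : forall r, 0 < r < 1 -> forall t, continuous (u r) t)
  by (intros r Hr t; now apply (Cmod_HolC_polar_continuous _ r t Hp)).
assert (Cv : forall r, 0 < r < 1 -> forall t, continuous (v r) t)
  by (intros r Hr t; now apply (Cmod_HolC_polar_continuous _ r t Hm)).
unfold HpB_norm; rewrite Lub_radii_finite_iff, bounded_on_radii_root; [ | exact hp | ].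
2: { intros r Hr; rewrite (Hw r Hr); apply RInt_ge_0; [ exact HPI | | ].
     - apply ex_RInt_rpow_rms; auto.
     - intros; apply rpow_ge0. }
split.
- intros [M HM]; split; exists (rpow (sqrt 2) p * M); intros r Hr;
    specialize (HM r Hr); rewrite (Hw r Hr) in HM;
    (eapply Rle_trans; [ | apply (Rmult_le_compat_l _ _ _ (rpow_ge0 (sqrt 2) p) HM) ]).
  + apply RInt_rpow_le_rms; auto.
  + rewrite (RInt_ext (fun t => rpow (rms (u r t) (v r t)) p)
      (fun t => rpow (rms (v r t) (u r t)) p))
      by (intros; now rewrite rms_comm).
    apply RInt_rpow_le_rms; auto.
- intros [[Mp HMp] [Mm HMm]]; exists (Mp + Mm); intros r Hr; rewrite (Hw r Hr).
  eapply Rle_trans; [ apply RInt_rpow_rms_le; auto | ].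
  apply Rplus_le_compat; auto.
Qed.
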